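(* Let $(M,g)$ be a Lorentzian manifold, $f:M\to\mathbb{R}$ a locally Lipschitz, locally anti-Lipschitz time function, and $d(\cdot,\cdot;f)$ the null distance associated to $f$. Let $(\gamma_i:[0,b_i)\to M)_{i\in\mathbb{N}}$, $b_i\in(0,\infty]$, be a sequence of past directed inextendible continuous causal curves in $M$ such that $\gamma_i(0)\to x$ for some $x\in M$. For each $i$ let $a_i=\lim_{t\to b_i}\big(f(\gamma_i(0))-f(\gamma_i(t))\big)\in(0,\infty]$ and let $s_i:[0,a_i)\to[0,b_i)$ be the change of parameter determined by $f(\gamma_i(s_i(t)))=f(\gamma_i(0))-t$. Let $\gamma:[0,a)\to M$, $a\in(0,\infty]$, be a limit curve of the sequence $(\gamma_i\circ s_i)_i$ with associated subsequence $(\gamma_{i_k}\circ s_{i_k})_k$, that is: $\gamma$ is continuous, $\gamma(0)=x$, $a\le\limsup_k a_{i_k}$, and $(\gamma_{i_k}\circ s_{i_k})_k$ $d(\cdot,\cdot;f)$-converges uniformly on compacta to $\gamma$. Suppose that for all $r\in(-\infty,f(\gamma(0)))\cap\operatorname{ran}(f)$ we have $\gamma\cap f^{-1}(r)\ne\varnothing$ and there exists $N\in\mathbb{N}$ such that $\gamma_{i_k}\cap f^{-1}(r)\neq\varnothing$ for all $k\ge N$. Then there exists a subsequence $(\gamma_{i_{k_j}})_j$ of $(\gamma_{i_k})_k$ such that $$a=\limsup_j a_{i_{k_j}}.$$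
   Context: Manifolds are smooth, Hausdorff, paracompact; Lorentzian metrics are smooth with signature $(-,+,\dots,+)$ and $M$ is time-oriented. A continuous curve $\gamma:I\to M$ is future directed causal if each $t\in I$ has a neighbourhood $J\subset I$ and a convex normal neighbourhood $U$ of $\gamma(t)$ with $\gamma(J)\subset U$ such that for all $t_1<t_2$ in $J$, $\gamma(t_1)\ne\gamma(t_2)$ and the geodesic in $U$ from $\gamma(t_1)$ to $\gamma(t_2)$ is future directed causal; past directed is dual. A past directed causal $\gamma:[0,b)\to M$ is inextendible if $\gamma(t)$ has no limit in $M$ as $t\to b$. A curve name such as $\gamma$ also denotes its image. $\operatorname{ran}(f)$ is the range of $f$. A generalised time function is a function (strictly) increasing along every future directed causal curve; a time function is a continuous one. $f$ is locally Lipschitz if on any compact subset of a chart it is Lipschitz with respect to the Euclidean distance of the chart (equivalently any Riemannian distance). $f$ is anti-Lipschitz on an open set $U$ if there is a Riemannian metric $h$ on $U$ such that $f(\gamma(1))-f(\gamma(0))\ge L(\gamma;h)$ ($h$-length) for every future directed causal $\gamma:[0,1]\to U$; it is locally anti-Lipschitz if it is anti-Lipschitz on a neighbourhood of each point. Null distance: an alternating causal curve is a continuous, piecewise smooth $\beta:[u,v]\to M$ with a finite partition $u=t_1<\dots<t_k=v$ such that each $\beta|_{[t_i,t_{i+1}]}$ is a smooth future or past directed causal curve; $L(\beta;f)=\sum_{i=1}^{k-1}|f(\beta(t_{i+1}))-f(\beta(t_i))|$; and $d(p,q;f)=\inf\{L(\beta;f):\beta\text{ an alternating causal curve from }p\text{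 to }q\}$. Curves $\beta_k:[0,c_k)\to M$ with $\beta_k(0)\to x$ $d$-converge uniformly on compacta to $\gamma:[0,a)\to M$ if $\gamma(0)=x$ and for all $\delta<a$ there is $N_\delta$ such that $k\ge N_\delta$ implies $c_k>\delta$, and $(\beta_k|_{[0,\delta]})_{k\ge N_\delta}$ converges uniformly to $\gamma|_{[0,\delta]}$ with respect to $d$. *)

(* Defs.v *)
From HB Require Import structures.
From mathcomp Require Import all_boot all_order all_algebra.
From mathcomp Require Import all_classical all_reals all_analysis.

Set Implicit Arguments.
Unset Strict Implicit.
Unset Printing Implicit Defensive.

Import Order.TTheory GRing.Theory Num.Theory.
Import numFieldNormedType.Exports.

Local Open Scope classical_set_scope.
Local Open Scope ring_scope.

Section Smooth.
Context {R : realType} {V W : normedModType R}.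

(* For U open (the only use) and V finite-dimensional, this is the usual C^k
   class on U: iterated directional derivatives exist and are continuous. *)
Fixpoint class_C (k : nat) (U : set V) (f : V -> W) : Prop :=
  match k with
  | 0 => forall x, U x -> {for x, continuous f}
  | k'.+1 => (forall x, U x -> differentiable f x) /\
             (forall v, class_C k' U (fun x => 'D_v f x))
  end.

Definition smooth_on (U : set V) (f : V -> W) : Prop :=
  forall k, class_C k U f.

End Smooth.

Definition paracompact (T : topologicalType) : Prop :=
  forall C : set (set T),
    (forall A, C A -> open A) -> \bigcup_(A in C) A = setT ->
    exists D : set (set T),
      [/\ forall B, D B -> open B /\ exists2 A, C A & B `<=` A,
          \bigcup_(B in D) B = setT &
          forall p : T, exists2 N, nbhs p N &
            finite_set [set B | D B /\ B `&` N !=set0]].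

(* A chart is given by total maps; only their values on [chart_dom] and on its
   image are relevant. *)
Record chart (R : realType) (n : nat) (T : Type) := Chart {
  chart_dom : set T;
  chart_map : T -> 'rV[R]_n;
  chart_inv : 'rV[R]_n -> T }.

Definition is_chart (R : realType) (n : nat) (T : topologicalType)
    (c : chart R n T) : Prop :=
  [/\ open (chart_dom c), open (chart_map c @` chart_dom c),
      forall p, chart_dom c p -> chart_inv c (chart_map c p) = p,
      {within chart_dom c, continuous (chart_map c)} &
      {within chart_map c @` chart_dom c, continuous (chart_inv c)}].

Definition transition (R : realType) (n : nat) (T : Type)
    (c c' : chart R n T) : 'rV[R]_n -> 'rV[R]_n :=
  fun x => chart_map c' (chart_inv c x).

Definition smooth_transition (R : realType) (n : nat) (T : Type)
    (c c' : chart R n T) : Prop :=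
  smooth_on (chart_map c @` (chart_dom c `&` chart_dom c')) (transition c c').

Record smoothManifold (R : realType) (n : nat) := SmoothManifold {
  manifold_space :> topologicalType;
  atlas : set (chart R n manifold_space);
  manifold_hausdorff : hausdorff_space manifold_space;
  manifold_paracompact : paracompact manifold_space;
  atlas_chart : forall c, atlas c -> is_chart c;
  atlas_cover : forall p, exists2 c, atlas c & chart_dom c p;
  atlas_smooth : forall c c', atlas c -> atlas c' -> smooth_transition c c';
  atlas_maximal : forall c, is_chart c ->
    (forall c', atlas c' -> smooth_transition c c' /\ smooth_transition c' c) ->
    atlas c }.

(* A tangent vector at [p] is represented by its components in a chart around
    [p], and a field by its components in every chart, subject to the usual
    transformation law. *)

Section Tensors.
Context {R : realType} {n : nat} (M : smoothManifold R n).
Implicit Types (c : chart R n M) (p : M) (U : set M) (v w : 'rV[R]_n).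

Definition push_vector c c' p v : 'rV[R]_n :=
  'D_v (transition c c') (chart_map c p).

Definition vector_field := chart R n M -> M -> 'rV[R]_n.

Definition is_continuous_vector_field (X : vector_field) : Prop :=
  (forall c, atlas c -> {within chart_dom c, continuous (X c)}) /\
  (forall c c' p, atlas c -> atlas c' -> chart_dom c p -> chart_dom c' p ->
     X c' p = push_vector c c' p (X c p)).

Definition bilinear_field := chart R n M -> M -> 'M[R]_n.

Definition inner (G : 'M[R]_n) v w : R := (v *m G *m w^T) 0 0.

Definition is_smooth_bilinear_field U (g : bilinear_field) : Prop :=
  (forall c, atlas c ->
     smooth_on (chart_map c @` (chart_dom c `&` U))
               (fun x => g c (chart_inv c x))) /\
  (forall c c' p, atlas c -> atlas c' ->
     chart_dom c p -> chart_dom c' p -> U p ->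
     forall v w, inner (g c p) v w =
                 inner (g c' p) (push_vector c c' p v) (push_vector c c' p w)).

Definition is_riemannian_metric U (h : bilinear_field) : Prop :=
  is_smooth_bilinear_field U h /\
  forall c p, atlas c -> chart_dom c p -> U p ->
    (h c p)^T = h c p /\ forall v, v != 0 -> 0 < inner (h c p) v v.

End Tensors.

Definition minkowski (R : realType) (m : nat) : 'M[R]_m.+1 :=
  diag_mx (\row_i (if i == 0 then - 1 else 1)).

Definition is_lorentzian_metric (R : realType) (m : nat)
    (M : smoothManifold R m.+1) (g : bilinear_field M) : Prop :=
  is_smooth_bilinear_field setT g /\
  forall c p, atlas c -> chart_dom c p ->
    exists2 P : 'M[R]_m.+1, P \in unitmx & P *m g c p *m P^T = minkowski R m.

(* The time orientation is given by a continuous timelike vector field, which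
   is declared to be future directed. *)
Record lorentzManifold (R : realType) (m : nat) := LorentzManifold {
  lorentz_manifold :> smoothManifold R m.+1;
  metric : bilinear_field lorentz_manifold;
  metric_lorentzian : is_lorentzian_metric metric;
  time_field : vector_field lorentz_manifold;
  time_field_continuous : is_continuous_vector_field time_field;
  time_field_timelike : forall c p, atlas c -> chart_dom c p ->
    inner (metric c p) (time_field c p) (time_field c p) < 0 }.

Inductive time_direction := Future | Past.

(* A curve on an interval I is a total map [R -> M] of which only the
    restriction to I matters. *)

(* Partitions are those of [itv_partition a b s]: [a] followed by the list [s],
   which is increasing and ends at [b]. *)
Definition node (R : realType) (a : R) (s : seq R) (i : nat) : R :=
  nth a (a :: s) i.

Section Curves.
Context {R : realType} {n : nat} (M : smoothManifold R n).
Implicit Types (c : chart R n M) (I : set R) (gamma beta : R -> M).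

(* [w] is a smooth extension, to a neighbourhood of [t] in R, of the expression
   of [gamma] restricted to [I] in the chart [c]. *)
Definition local_rep c I gamma (t : R) (w : R -> 'rV[R]_n) : Prop :=
  atlas c /\
  exists2 e : R, 0 < e &
    smooth_on (ball t e) w /\
    forall s, I s -> ball t e s ->
      chart_dom c (gamma s) /\ w s = chart_map c (gamma s).

Definition is_speed (h : bilinear_field M) (a b : R) beta (rho : R -> R) :=
  forall t, `[a, b]%classic t ->
    exists c w, local_rep c `[a, b]%classic beta t w /\
      rho t = Num.sqrt (inner (h c (beta t)) (derive1 w t) (derive1 w t)).

(* Distance of the Riemannian manifold (U, h); [+oo] between points of distinct
   components. *)
Definition riemannian_dist (h : bilinear_field M) (U : set M) (p q : M) :
    \bar R :=
  ereal_inf [set l | exists beta a b (s : seq R) (rho : nat -> R -> R),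
    [/\ {within `[a, b]%classic, continuous beta}, itv_partition a b s,
        forall t, `[a, b]%classic t -> U (beta t) &
        forall i, (i < size s)%N ->
          is_speed h (node a s i) (node a s i.+1) beta (rho i)] /\
    [/\ beta a = p, beta b = q &
        l = (\sum_(i < size s)
              \int[lebesgue_measure]_(t in
                 `[node a s i, node a s i.+1]) rho i t)%:E]].

(* Length of a merely continuous curve [0, 1] -> U as the supremum of the
   lengths of inscribed polygons; for Lipschitz curves this is the integral of
   the speed. *)
Definition curve_length (h : bilinear_field M) (U : set M) gamma : \bar R :=
  ereal_sup [set l | exists2 s : seq R, itv_partition 0 1 s &
    l = (\sum_(i < size s)
          riemannian_dist h U (gamma (node 0%R s i))
                              (gamma (node 0%R s i.+1)))%E].

End Curves.

Section Geodesics.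
Context {R : realType} {m : nat} (M : lorentzManifold R m).
Implicit Types (c : chart R m.+1 M) (I : set R) (p q : M) (U : set M).

Definition metric_coord c (i j : 'I_m.+1) : 'rV[R]_m.+1 -> R :=
  fun x => metric c (chart_inv c x) i j.

Definition partial (i : 'I_m.+1) (F : 'rV[R]_m.+1 -> R) : 'rV[R]_m.+1 -> R :=
  fun x => 'D_(delta_mx 0 i) F x.

(* Gamma^k_ij of the Levi-Civita connection, in the coordinates of [c] *)
Definition christoffel c (x : 'rV[R]_m.+1) (k i j : 'I_m.+1) : R :=
  2^-1 * \sum_l invmx (metric c (chart_inv c x)) k l *
    (partial i (metric_coord c j l) x + partial j (metric_coord c i l) x
     - partial l (metric_coord c i j) x).

Definition is_geodesic I (sigma : R -> M) : Prop :=
  forall t, I t -> exists c w, local_rep c I sigma t w /\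
    forall k, (derive1 (derive1 w) t) 0 k +
      \sum_i \sum_j christoffel c (w t) k i j *
        (derive1 w t) 0 i * (derive1 w t) 0 j = 0.

(* exp_p(v) = q, for v a tangent vector at p with components [v] in [c] *)
Definition exp_rel c p (v : 'rV[R]_m.+1) q : Prop :=
  exists sigma : R -> M,
    [/\ is_geodesic `[0, 1]%classic sigma, sigma 0 = p, sigma 1 = q &
        exists2 w, local_rep c `[0, 1]%classic sigma 0 w & derive1 w 0 = v].

Definition is_diffeo (V : set 'rV[R]_m.+1) U (E : 'rV[R]_m.+1 -> M) : Prop :=
  exists F : M -> 'rV[R]_m.+1,
    [/\ forall v, V v -> U (E v) /\ F (E v) = v,
        forall q, U q -> V (F q) /\ E (F q) = q,
        {within V, continuous E} &
        forall c, atlas c ->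
          smooth_on (V `&` E @^-1` chart_dom c) (chart_map c \o E) /\
          smooth_on (chart_map c @` (chart_dom c `&` U)) (F \o chart_inv c)].

Definition is_normal_nbhd p U : Prop :=
  exists c (V : set 'rV[R]_m.+1) (E : 'rV[R]_m.+1 -> M),
    [/\ atlas c, chart_dom c p, open V &
        V 0 /\ forall v (r : R), V v -> 0 <= r <= 1 -> V (r *: v)] /\
    [/\ forall v, V v -> exp_rel c p v (E v) & is_diffeo V U E].

Definition convex_normal U : Prop :=
  open U /\ forall p, U p -> is_normal_nbhd p U.

Definition causal_vector (d : time_direction) c p (v : 'rV[R]_m.+1) : Prop :=
  [/\ v != 0, inner (metric c p) v v <= 0 &
      match d with
      | Future => inner (metric c p) (time_field c p) v < 0
      | Past => 0 < inner (metric c p) (time_field c p) v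
      end].

Definition smooth_causal (d : time_direction) (a b : R) (beta : R -> M) :=
  forall t, `[a, b]%classic t ->
    exists c w, local_rep c `[a, b]%classic beta t w /\
      causal_vector d c (beta t) (derive1 w t).

(* A geodesic from p to q inside a convex normal U is unique (up to affine
   reparametrisation), so it may be introduced existentially below. *)
Definition geodesic_in U p q (sigma : R -> M) : Prop :=
  [/\ is_geodesic `[0, 1]%classic sigma,
      forall t, `[0, 1]%classic t -> U (sigma t), sigma 0 = p & sigma 1 = q].

Definition causal_curve (d : time_direction) I (gamma : R -> M) : Prop :=
  {within I, continuous gamma} /\
  forall t, I t -> exists (J : set R) U,
    [/\ nbhs t J, convex_normal U, U (gamma t),
        forall s, I s -> J s -> U (gamma s) &
        forall t1 t2, I t1 -> J t1 -> I t2 -> J t2 -> t1 < t2 ->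
          gamma t1 <> gamma t2 /\
          exists2 sigma, geodesic_in U (gamma t1) (gamma t2) sigma &
                         smooth_causal d 0 1 sigma].

Definition time_function (f : M -> R) : Prop :=
  continuous f /\
  forall I gamma, is_interval I -> causal_curve Future I gamma ->
    forall t1 t2, I t1 -> I t2 -> t1 < t2 -> f (gamma t1) < f (gamma t2).

Definition euclidean_norm (v : 'rV[R]_m.+1) : R :=
  Num.sqrt (\sum_i v 0 i ^+ 2).

Definition locally_lipschitz (f : M -> R) : Prop :=
  forall c (K : set M), atlas c -> compact K -> K `<=` chart_dom c ->
    exists L : R, forall p q, K p -> K q ->
      `|f p - f q| <= L * euclidean_norm (chart_map c p - chart_map c q).

Definition anti_lipschitz_on U (f : M -> R) : Prop :=
  exists2 h : bilinear_field M, is_riemannian_metric U h &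
    forall gamma, causal_curve Future `[0, 1]%classic gamma ->
      (forall t, `[0, 1]%classic t -> U (gamma t)) ->
      (curve_length h U gamma <= (f (gamma 1) - f (gamma 0))%:E)%E.

Definition locally_anti_lipschitz (f : M -> R) : Prop :=
  forall p, exists U, [/\ open U, U p & anti_lipschitz_on U f].

Definition alternating_causal (a b : R) (s : seq R) (beta : R -> M) : Prop :=
  [/\ {within `[a, b]%classic, continuous beta}, itv_partition a b s &
      forall i, (i < size s)%N -> exists d : time_direction,
        smooth_causal d (node a s i) (node a s i.+1) beta].

Definition null_length (f : M -> R) (a : R) (s : seq R) (beta : R -> M) : R :=
  \sum_(i < size s)
    `|f (beta (node a s i.+1)) - f (beta (node a s i))|.

(* [+oo] if there is no alternating causal curve from [p] to [q] *)
Definition null_dist (f : M -> R) (p q : M) : \bar R :=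
  ereal_inf [set l | exists beta a b s,
    [/\ alternating_causal a b s beta, beta a = p, beta b = q &
        l = (null_length f a s beta)%:E]].

End Geodesics.

Definition ico (R : realType) (b : \bar R) : set R :=
  [set t | 0 <= t /\ (t%:E < b)%E].

(* The filter t -> b, t < b (only used for 0 < b, so the value at [-oo] is
   irrelevant). *)
Definition to_end (R : realType) (b : \bar R) : set_system R :=
  if b is b'%:E then at_left b' else pinfty_nbhs R.

Definition past_inextendible (R : realType) (m : nat) (M : lorentzManifold R m)
    (b : \bar R) (gamma : R -> M) : Prop :=
  causal_curve Past (ico b) gamma /\
  ~ exists p : M, gamma t @[t --> to_end b] --> p.

Definition total_drop (R : realType) (m : nat) (M : lorentzManifold R m)
    (f : M -> R) (b : \bar R) (gamma : R -> M) (a : \bar R) : Prop :=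
  (f (gamma 0) - f (gamma t))%:E @[t --> to_end b] --> a.

Definition f_parameter (R : realType) (m : nat) (M : lorentzManifold R m)
    (f : M -> R) (b : \bar R) (gamma : R -> M) (a : \bar R) (s : R -> R) :
    Prop :=
  forall t, ico a t -> ico b (s t) /\ f (gamma (s t)) = f (gamma 0) - t.

Definition uniform_cvg_on_compacta (R : realType) (T : topologicalType)
    (d : T -> T -> \bar R) (x : T) (c : nat -> \bar R) (beta : nat -> R -> T)
    (a : \bar R) (gamma : R -> T) : Prop :=
  [/\ beta k 0 @[k --> \oo] --> x, gamma 0 = x &
      forall delta : R, (delta%:E < a)%E ->
        (exists N, forall k, (N <= k)%N -> (delta%:E < c k)%E) /\
        (forall e : R, 0 < e -> \forall k \near \oo,
           forall t, 0 <= t <= delta -> (d (beta k t) (gamma t) < e%:E)%E)].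

Definition subsequence (phi : nat -> nat) : Prop :=
  {homo phi : i j / (i < j)%N}.

Definition limit_curve (R : realType) (m : nat) (M : lorentzManifold R m)
    (f : M -> R) (x : M) (c : nat -> \bar R) (beta : nat -> R -> M)
    (a : \bar R) (gamma : R -> M) (phi : nat -> nat) : Prop :=
  [/\ subsequence phi, {within ico a, continuous gamma}, gamma 0 = x,
      (a <= limn_esup (fun k => c (phi k)))%E &
      uniform_cvg_on_compacta (null_dist f) x
        (fun k => c (phi k)) (fun k => beta (phi k)) a gamma].

(* Main.v *)
(* Since |f p - f q| <= d(p, q; f), the limit curve satisfies
   f (gamma t) = f x - t. As gamma meets every level of f below f x, the value
   f x - a is a lower bound of f on all of M; hence a_i <= f (gamma_i 0) - f x + a
   for every i, and limsup a_(phi k) <= a. Thus the given subsequence itself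
   already realises the limsup. *)
Require Import Defs.
From mathcomp Require Import all_boot all_order all_algebra.
From mathcomp Require Import all_classical all_reals all_analysis.
Import Order.TTheory GRing.Theory Num.Theory.
Import numFieldNormedType.Exports.
Local Open Scope classical_set_scope.
Local Open Scope ring_scope.

Lemma null_length_ge_dist (R : realType) (m : nat) (M : lorentzManifold R m)
    (f : M -> R) (a b : R) (s : seq R) (beta : R -> M) :
  itv_partition a b s -> `|f (beta b) - f (beta a)| <= null_length f a s beta.
Proof.
move=> sP; apply: le_trans (ler_norm_sum _ _ _).
rewrite -(big_mkord xpredT
  (fun i => f (beta (node a s i.+1)) - f (beta (node a s i)))).
by rewrite telescope_sumr// /node (itv_partition_nth_size a sP).
Qed.

(** Makes [f] 1-Lipschitz for the null distance, so that [d]-convergence of curves forces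
    convergence of [f] along them. The increments of [f] over a partition telescope. *)
Lemma null_dist_ge_dist (R : realType) (m : nat) (M : lorentzManifold R m)
    (f : M -> R) (p q : M) : (`|f p - f q|%:E <= null_dist f p q)%E.
Proof.
apply: le_ereal_inf_tmp => _ [beta [a [b [s [[_ sP _] <- <- ->]]]]].
by rewrite lee_fin distrC; exact: null_length_ge_dist.
Qed.

Lemma to_end_proper (R : realType) (b : \bar R) : ProperFilter (to_end b).
Proof. by case: b => [b| |] /=; exact _. Qed.

(** The upper limit is an infimum of suprema over the sets of the filter, and the set where the
    bound holds is one of these. *)
Lemma limn_esup_le_near (R : realType) (u : nat -> \bar R) (l : \bar R) :
  (\forall k \near \oo, (u k <= l)%E) -> (limn_esup u <= l)%E.
Proof.
move=> ul; rewrite /limn_esup limf_esupE.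
apply: ge_ereal_inf; exists (ereal_sup (u @` [set k | (u k <= l)%E])).
  by exists [set k | (u k <= l)%E].
by apply: ge_ereal_sup => _ [k + <-].
Qed.

Lemma total_drop_le (R : realType) (m : nat) (M : lorentzManifold R m)
    (f : M -> R) (b a : \bar R) (gamma : R -> M) (l : R) :
  (forall p, l <= f p) -> total_drop f b gamma a ->
  (a <= (f (gamma 0) - l)%:E)%E.
Proof.
move=> lf; have ? := @to_end_proper R b.
by apply: cvge_le; apply: nearW => t; rewrite lee_fin lerD2l lerN2.
Qed.

(** Two limits of one sequence are compared: [f (gamma_ (phi k) 0) - t], the value of [f] on the
    [k]-th reparametrised curve at [t], tends to both sides. *)
Lemma limit_curve_level (R : realType) (m : nat) (M : lorentzManifold R m)
    (f : M -> R) (x : M) (b_ : nat -> \bar R) (gamma_ : nat -> R -> M)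
    (a_ : nat -> \bar R) (s_ : nat -> R -> R)
    (a : \bar R) (gamma : R -> M) (phi : nat -> nat) :
  continuous f -> (forall i, (0 < a_ i)%E) ->
  (forall i, f_parameter f (b_ i) (gamma_ i) (a_ i) (s_ i)) ->
  limit_curve f x a_ (fun i => gamma_ i \o s_ i) a gamma phi ->
  forall t, ico a t -> f (gamma t) = f x - t.
Proof.
move=> fC a_gt0 sP [_ _ _ _ [bx g0 cvg]] t [t_ge0 ta].
have [[N aN] dP] := cvg t ta.
have fgx : f (gamma_ (phi k) 0) @[k --> \oo] --> f x.
  have := cvg_comp _ _ bx (fC x); apply: cvg_trans; apply: near_eq_cvg.
  (* [bx] concerns the points [gamma_ (phi k) (s_ (phi k) 0)]; the parameter relation at [0] equates
     their [f]-values with those of [gamma_ (phi k) 0]. *)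
  apply: nearW => k /=; have [|_ ->] := sP (phi k) 0; last by rewrite subr0.
  by split=> //; exact: a_gt0.
apply: (@cvg_unique _ (@norm_hausdorff _ R^o)
         ((fun k => f (gamma_ (phi k) 0) - t : R^o) @ \oo)).
  apply/cvgrPdist_lt => e e_gt0; near=> k.
  have tk : ico (a_ (phi k)) t by split=> //; apply: aN; near: k; exact: nbhs_infty_ge.
  have [_ <-] := sP (phi k) t tk; rewrite distrC -lte_fin.
  apply: le_lt_trans (null_dist_ge_dist _ _ _ _ _ _) _.
  have : forall u, 0 <= u <= t ->
      (null_dist f ((gamma_ (phi k) \o s_ (phi k)) u) (gamma u) < e%:E)%E.
    by near: k; exact: dP.
  by apply; rewrite t_ge0 lexx.
by apply: cvgB => //; exact: cvg_cst.
Unshelve. all: by end_near. Qed.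

Theorem proposition4p3 (R : realType) (m : nat) (M : lorentzManifold R m)
    (f : M -> R)
    (f_time : time_function f)
    (f_lip : locally_lipschitz f)
    (f_antilip : locally_anti_lipschitz f)
    (x : M) (b_ : nat -> \bar R) (gamma_ : nat -> R -> M)
    (b_gt0 : forall i, (0 < b_ i)%E)
    (gamma_inext : forall i, past_inextendible (b_ i) (gamma_ i))
    (gamma_x : gamma_ i 0 @[i --> \oo] --> x)
    (a_ : nat -> \bar R) (s_ : nat -> R -> R)
    (a_def : forall i, total_drop f (b_ i) (gamma_ i) (a_ i))
    (a_gt0 : forall i, (0 < a_ i)%E)
    (s_def : forall i, f_parameter f (b_ i) (gamma_ i) (a_ i) (s_ i))
    (a : \bar R) (gamma : R -> M) (phi : nat -> nat)
    (a_pos : (0 < a)%E)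
    (gamma_lim :
       limit_curve f x a_ (fun i => gamma_ i \o s_ i) a gamma phi)
    (hlevel : forall r : R, r < f (gamma 0) -> range f r ->
       (exists2 t, ico a t & f (gamma t) = r) /\
       (exists N, forall k, (N <= k)%N ->
          exists2 t, ico (b_ (phi k)) t & f (gamma_ (phi k) t) = r)) :
  exists2 psi : nat -> nat, subsequence psi &
    a = limn_esup (fun j => a_ (phi (psi j))).
Proof.
exists id; first by [].
have [phiP _ g0 a_le cvg] := gamma_lim.
have fC : continuous f by have [] := f_time.
have glevel := limit_curve_level R m M f x b_ gamma_ a_ s_ a gamma phi
  fC a_gt0 s_def gamma_lim.
apply: le_anti; rewrite a_le /=.
(* Only finite [a] needs work: [-oo] contradicts [a_pos], and [+oo] bounds everything. *)
case: a a_pos gamma_lim hlevel a_le cvg glevel => [a| |] // a_pos _ hlevel _ _ glevel;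
  last by rewrite leey.
have fge p : f x - a <= f p.
  have [xp|px] := leP (f x) (f p).
    by apply: le_trans xp; rewrite gerBl ltW// -lte_fin.
  (* A value below [f x] is attained on [gamma] at some [t < a], where [f] equals [f x - t]. *)
  have [||[t ta ft] _] := hlevel (f p); [by rewrite g0|by exists p|].
  rewrite -ft glevel// lerD2l lerN2 ltW// -lte_fin.
  by case: ta.
(* The slack [e] absorbs the difference between [f (gamma_ i 0)] and its limit [f x]. *)
apply/lee_addgt0Pr => e e_gt0; apply: limn_esup_le_near.
have fgx : f (gamma_ i 0) @[i --> \oo] --> f x.
  exact: cvg_comp gamma_x (fC x).
have phi_ge k : (k <= phi k)%N.
  by elim: k => // k IH; apply: leq_ltn_trans IH _; exact: phiP.
have phi_oo : phi k @[k --> \oo] --> \oo.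
  apply/cvgnyPge => N; near=> k; apply: leq_trans (phi_ge k).
  by near: k; exact: nbhs_infty_ge.
have /cvgrPdist_lt/(_ _ e_gt0) := cvg_comp _ _ phi_oo fgx.
apply: filterS => k /= /ltW; rewrite distrC ler_distl => /andP[_ fle].
(* The lower bound [f x - a] gives a drop of at most [f (gamma_ i 0) - f x + a] with [i = phi k],
   and [fle] bounds this by [a + e]. *)
apply: le_trans (total_drop_le _ _ _ _ _ _ _ _ fge (a_def _)) _.
rewrite -EFinD lee_fin opprB addrCA lerD2l.
by rewrite lerBlDl.
Unshelve. all: by end_near. Qed.
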